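(* Let $p>0$ and let $w$ be a weight on $[0,2\pi)$. If $\log w\in L^p$, then $(L_p,\rho^w_p)$ is an $F$-algebra, and the metric topologies of $\rho^w_p$ and $\rho_p$ on $L_p$ are the same.
   Context: A weight is a Lebesgue measurable function $w:[0,2\pi)\to[0,\infty)$ with $w(t)>0$ for almost every $t$. $L^p$ is the Lebesgue space $L^p([0,2\pi),dt/2\pi)$. For $p>0$ and a weight $w$, $L^w_p$ is the class of all (a.e.-equivalence classes of) complex-valued measurable functions $f$ on $[0,2\pi)$ with $$(\|f\|^w_p)^p:=\int_0^{2\pi}(\log(1+|f(t)|w(t)))^p\,\frac{dt}{2\pi}<\infty,$$ with the translation invariant metric $\rho^w_p(f,g)=(\|f-g\|^w_p)^{\min\{p,1\}}$. For $w\equiv1$ these are denoted $L_p$, $\|\cdot\|_p$ and $\rho_p$; $L_p$ is an algebra under pointwise operations. When $\log^+w=\max\{\log w,0\}\in L^p$ one has $L_p\subset L^w_p$, so $\rho^w_p$ is a metric on $L_p$. An $F$-algebra is a topological algebra (a topological vector space with continuous multiplication) whose topology is given by a complete translation invariant metric; $(L_p,\rho^w_p)$ is an $F$-algebra if this holds with the metric $\rho^w_p$. *)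

(* Defs.v *)
From HB Require Import structures.
From mathcomp Require Import all_boot all_order all_algebra.
From mathcomp Require Import complex.
From mathcomp Require Import all_classical all_reals all_analysis.
From mathcomp Require Import measurable_realfun.
Set Implicit Arguments.
Unset Strict Implicit.
Unset Printing Implicit Defensive.
Import Order.TTheory GRing.Theory Num.Theory.
Import numFieldTopology.Exports numFieldNormedType.Exports.
Local Open Scope classical_set_scope.
Local Open Scope ring_scope.

Section circle.
Context {R : realType}.

(* The interval [0, 2 pi[ as a type. *)
Definition circle : Type := {t : R | 0 <= t < 2 * pi}.

HB.instance Definition _ := Choice.on circle.

Lemma circle0_subproof : 0 <= (0 : R) < 2 * pi.
Proof. by rewrite lexx/= mulr_gt0// pi_gt0. Qed.

HB.instance Definition _ :=
  isPointed.Build circle (exist _ 0 circle0_subproof).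

Definition lebesgueTypeR := caratheodory_type (@wlength R idfun)^*%mu.

(* The sigma-algebra on [0, 2 pi[ is the trace of the Lebesgue (completed, not
   just Borel) sigma-algebra of R. *)
Definition angle (t : circle) : lebesgueTypeR := sval t.

HB.instance Definition _ :=
  Measurable.copy circle (g_sigma_algebra_preimageType angle).

Lemma angle_inj : injective angle.
Proof. exact: val_inj. Qed.

Lemma range_angle : range angle = [set t | 0 <= t < 2 * pi].
Proof.
apply/seteqP; split => [_ [t _ <-]|t /= ht]; first exact: (svalP t).
by exists (exist _ t ht).
Qed.

Lemma measurable_range_angle : measurable (range angle).
Proof.
rewrite range_angle.
have -> : [set t : lebesgueTypeR | 0 <= t < 2 * pi] = `[0, 2 * pi[%classic.
  by apply/seteqP; split => t /=; rewrite in_itv.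
apply: sub_caratheodory.
exact: (@measurable_itv R `[0, 2 * pi[).
Qed.

Lemma measurable_image_angle (A : set circle) :
  measurable A -> measurable (angle @` A).
Proof.
move=> [B mB <-]; rewrite setTI.
have -> : angle @` (angle @^-1` B) = B `&` range angle.
  apply/seteqP; split => [_ [t Bt <-]|x [Bx [t _ tx]]]; first by split => //; exists t.
  by exists t => //=; rewrite tx.
by apply: measurableI => //; exact: measurable_range_angle.
Qed.

(* dt / 2 pi *)
Definition circle_measure (A : set circle) : \bar R :=
  ((2 * pi)^-1%:E * completed_lebesgue_measure (angle @` A))%E.

Let circle_measure0 : circle_measure set0 = 0%E.
Proof.
rewrite /circle_measure image_set0.
by rewrite [X in (_ * X)%E](_ : _ = 0%E) ?mule0//.
Qed.

Let inv2pi_ge0 : 0 <= (2 * pi)^-1 :> R.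
Proof. by rewrite invr_ge0 mulr_ge0// pi_ge0. Qed.

Let circle_measure_ge0 A : (0 <= circle_measure A)%E.
Proof.
apply: mule_ge0; first by rewrite lee_fin.
exact: (measure_ge0 (@completed_lebesgue_measure R)).
Qed.

Let circle_measure_semi_sigma_additive : semi_sigma_additive circle_measure.
Proof.
move=> F mF tF mUF; rewrite /circle_measure image_bigcup.
have tF' : trivIset setT (fun i => angle @` F i).
  apply/trivIsetP => i j _ _ ij; apply/seteqP; split => // _ [[x Fx <-] [y Fy]].
  move=> /angle_inj xy; rewrite xy in Fy.
  by have /trivIsetP/(_ i j I I ij)/seteqP[+ _] := tF; apply; split; eassumption.
rewrite [X in X @ _ --> _](_ : _ = (fun n => ((2 * pi)^-1%:E *
   \sum_(0 <= i < n) completed_lebesgue_measure (angle @` F i))%E)); last first.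
  by apply/funext => n; rewrite ge0_sume_distrr.
apply: cvgeZl => //.
apply: (@measure_semi_sigma_additive _ _ _ (@completed_lebesgue_measure R)) => //.
  by move=> i; exact: measurable_image_angle.
by apply: bigcupT_measurable => i; exact: measurable_image_angle.
Qed.

HB.instance Definition _ := isMeasure.Build _ _ _ circle_measure
  circle_measure0 circle_measure_ge0 circle_measure_semi_sigma_additive.

Let circle_measure_setT : circle_measure setT = 1%E.
Proof.
rewrite /circle_measure range_angle.
have -> : [set t : lebesgueTypeR | 0 <= t < 2 * pi] = `[0, 2 * pi[%classic.
  by apply/seteqP; split => t /=; rewrite in_itv.
have -> : completed_lebesgue_measure `[0, 2 * pi[%classic =
    @lebesgue_measure R `[0, 2 * pi[%classic by [].
rewrite lebesgue_measure_itv/= lte_fin mulr_gt0// ?pi_gt0//.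
by rewrite sube0 -EFinM mulVf// mulf_neq0// gt_eqF// pi_gt0.
Qed.

HB.instance Definition _ := Measure_isProbability.Build _ _ _ circle_measure
  circle_measure_setT.

End circle.
Arguments circle R : clear implicits.
Arguments circle_measure R : clear implicits.

Section complex_measurable.
Context {R : realType}.

(* R[i] carries the sigma-algebra pulled back from R * R, which is its Borel
   sigma-algebra: a complex function is measurable iff its real and imaginary
   parts are. *)
Definition ReIm (z : R[i]) : R * R := (complex.Re z, complex.Im z).

HB.instance Definition _ := isPointed.Build R[i] 0.

HB.instance Definition _ :=
  Measurable.copy R[i] (g_sigma_algebra_preimageType ReIm).

Lemma measurable_ReIm : measurable_fun setT ReIm.
Proof. by move=> _ B mB; exists B. Qed.

Context {d} {T : measurableType d}.
Implicit Types f g : T -> R[i].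

Lemma measurable_complexP f : measurable_fun setT f <->
  measurable_fun setT (fun t => complex.Re (f t)) /\
  measurable_fun setT (fun t => complex.Im (f t)).
Proof.
have -> : measurable_fun setT f <-> measurable_fun setT (ReIm \o f).
  split => [mf|mf _ _ [B mB <-]].
    exact: measurableT_comp measurable_ReIm mf.
  by rewrite !setTI -comp_preimage -[X in measurable X]setTI; exact: mf.
exact: measurable_fun_pairP.
Qed.

Lemma measurable_complexD f g : measurable_fun setT f -> measurable_fun setT g ->
  measurable_fun setT (fun t => f t + g t).
Proof.
move=> /measurable_complexP[f1 f2] /measurable_complexP[g1 g2].
apply/measurable_complexP; split.
  rewrite (_ : (fun _ => _) = (fun t => complex.Re (f t) + complex.Re (g t))).
    exact: measurable_funD.
  by apply/funext => t; case: (f t) (g t) => [? ?] [? ?].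
rewrite (_ : (fun _ => _) = (fun t => complex.Im (f t) + complex.Im (g t))).
  exact: measurable_funD.
by apply/funext => t; case: (f t) (g t) => [? ?] [? ?].
Qed.

Lemma measurable_complexM f g : measurable_fun setT f -> measurable_fun setT g ->
  measurable_fun setT (fun t => f t * g t).
Proof.
move=> /measurable_complexP[f1 f2] /measurable_complexP[g1 g2].
apply/measurable_complexP; split.
  rewrite (_ : (fun _ => _) = (fun t => complex.Re (f t) * complex.Re (g t) -
      complex.Im (f t) * complex.Im (g t))).
    by apply: measurable_funB; exact: measurable_funM.
  by apply/funext => t; case: (f t) (g t) => [? ?] [? ?].
rewrite (_ : (fun _ => _) = (fun t => complex.Re (f t) * complex.Im (g t) +
    complex.Im (f t) * complex.Re (g t))).
  by apply: measurable_funD; exact: measurable_funM.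
by apply/funext => t; case: (f t) (g t) => [? ?] [? ?].
Qed.

Lemma measurable_normc f : measurable_fun setT f ->
  measurable_fun setT (fun t => Normc.normc (f t)).
Proof.
move=> /measurable_complexP[f1 f2].
rewrite (_ : (fun _ => _) = (fun t =>
    Num.sqrt (complex.Re (f t) ^+ 2 + complex.Im (f t) ^+ 2))).
  apply: (@measurableT_comp _ _ _ _ _ _ (@Num.sqrt R)).
    exact: continuous_measurable_fun (@sqrt_continuous R).
  by apply: measurable_funD; exact: measurable_funX.
by apply/funext => t; case: (f t).
Qed.

End complex_measurable.

Section L0.
Context {d} {T : measurableType d} {R : realType}.

(* Classes modulo P-a.e. equality of complex-valued measurable functions. An
   element coerces to a representative; the algebra operations are the
   pointwise ones (see L0_addE, L0_mulE, L0_scaleE below). *)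
Definition L0 (P : probability T R) : Type := {mfun_ P, T >-> R[i]}.

Context {P : probability T R}.
Implicit Types f g h : L0 P.

HB.instance Definition _ := Choice.on (L0 P).
HB.instance Definition _ := EqQuotient.on (L0 P).

Definition L0_fun f : T -> R[i] := aqEqMfun_to_fun f.
Coercion L0_fun : L0 >-> Funclass.

Lemma measurable_L0 f : measurable_fun setT f.
Proof. exact: measurable_funPT. Qed.

Lemma L0P f g : f = g <-> f = g %[ae P].
Proof.
split=> [->|fg]; first by apply: nearW.
by rewrite -[f]reprK -[g]reprK; apply/eqmodP/asboolP.
Qed.

Definition L0_class (u : T -> R[i]) (mu : measurable_fun setT u) : L0 P :=
  (\pi_({mfun_ P, T >-> R[i]}) (mfun_Sub (mem_set mu)))%qT.

Lemma L0_classE u (mu : measurable_fun setT u) : L0_class mu = u %[ae P].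
Proof.
have /eqmodP/asboolP : (repr (L0_class mu) = mfun_Sub (mem_set mu)
    %[mod {mfun_ P, T >-> R[i]}])%qT by rewrite reprK.
by [].
Qed.

Definition L0_const (c : R[i]) : L0 P :=
  L0_class (@measurable_cst _ _ T R[i] setT c).
Definition L0_add f g : L0 P :=
  L0_class (measurable_complexD (measurable_L0 f) (measurable_L0 g)).
Definition L0_mul f g : L0 P :=
  L0_class (measurable_complexM (measurable_L0 f) (measurable_L0 g)).
Definition L0_scale (c : R[i]) f : L0 P :=
  L0_class (measurable_complexM (@measurable_cst _ _ T R[i] setT c)
                                (measurable_L0 f)).
Definition L0_opp f : L0 P := L0_scale (-1) f.

Let constE c := L0_classE (@measurable_cst _ _ T R[i] setT c).
Let addE f g :=
  L0_classE (measurable_complexD (measurable_L0 f) (measurable_L0 g)).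
Let mulE f g :=
  L0_classE (measurable_complexM (measurable_L0 f) (measurable_L0 g)).
Let scaleE c f := L0_classE (measurable_complexM
  (@measurable_cst _ _ T R[i] setT c) (measurable_L0 f)).

Let addA : associative L0_add.
Proof.
move=> f g h; apply/L0P; apply: filterS
  (filterI (addE f (L0_add g h)) (filterI (addE g h) (filterI (addE (L0_add f g) h) (addE f g)))) =>
  t [e1 [e2 [e3 e4]]] _.
by rewrite e1// e2// e3// e4// addrA.
Qed.

Let addC : commutative L0_add.
Proof.
move=> f g; apply/L0P; apply: filterS
  (filterI (addE f g) (addE g f)) =>
  t [e1 e2] _.
by rewrite e1// e2// addrC.
Qed.

Let add0 : left_id (L0_const 0) L0_add.
Proof.
move=> f; apply/L0P; apply: filterS
  (filterI (addE (L0_const 0) f) (constE 0)) =>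
  t [e1 e2] _.
by rewrite e1// e2// add0r.
Qed.

Let addN : left_inverse (L0_const 0) L0_opp L0_add.
Proof.
move=> f; apply/L0P; apply: filterS
  (filterI (addE (L0_opp f) f) (filterI (scaleE (-1) f) (constE 0))) =>
  t [e1 [e2 e3]] _.
by rewrite e1// e2// e3// mulN1r addNr.
Qed.

HB.instance Definition _ := GRing.isZmodule.Build (L0 P) addA addC add0 addN.

Let mulA : associative L0_mul.
Proof.
move=> f g h; apply/L0P; apply: filterS
  (filterI (mulE f (L0_mul g h)) (filterI (mulE g h) (filterI (mulE (L0_mul f g) h) (mulE f g)))) =>
  t [e1 [e2 [e3 e4]]] _.
by rewrite e1// e2// e3// e4// mulrA.
Qed.

Let mulC : commutative L0_mul.
Proof.
move=> f g; apply/L0P; apply: filterS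
  (filterI (mulE f g) (mulE g f)) =>
  t [e1 e2] _.
by rewrite e1// e2// mulrC.
Qed.

Let mul1 : left_id (L0_const 1) L0_mul.
Proof.
move=> f; apply/L0P; apply: filterS
  (filterI (mulE (L0_const 1) f) (constE 1)) =>
  t [e1 e2] _.
by rewrite e1// e2// mul1r.
Qed.

Let mulD : left_distributive L0_mul L0_add.
Proof.
move=> f g h; apply/L0P; apply: filterS
  (filterI (mulE (L0_add f g) h) (filterI (addE f g) (filterI (addE (L0_mul f h) (L0_mul g h)) (filterI (mulE f h) (mulE g h))))) =>
  t [e1 [e2 [e3 [e4 e5]]]] _.
by rewrite e1// e2// e3// e4// e5// mulrDl.
Qed.

Let one_neq0 : L0_const 1 != L0_const 0.
Proof.
apply/negP => /eqP/L0P e10.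
have P0 : (0 < P setT)%E by rewrite probability_setT lte01.
have Pae := ae_properfilter_algebraOfSetsType P0.
have [t [e1 [e2 e3]]] := filter_ex (filterI e10 (filterI (constE 1) (constE 0))).
by move: (e1 I); rewrite e2// e3//= => /eqP; rewrite oner_eq0.
Qed.

HB.instance Definition _ := GRing.Zmodule_isComNzRing.Build (L0 P)
  mulA mulC mul1 mulD one_neq0.

Let scaleA a b f : L0_scale a (L0_scale b f) = L0_scale (a * b) f.
Proof.
apply/L0P; apply: filterS
  (filterI (scaleE a (L0_scale b f)) (filterI (scaleE b f) (scaleE (a * b) f))) =>
  t [e1 [e2 e3]] _.
by rewrite e1// e2// e3// mulrA.
Qed.

Let scale1 : left_id 1 L0_scale.
Proof.
by move=> f; apply/L0P; apply: filterS
  (scaleE 1 f) =>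
  t e1 _; rewrite e1// mul1r.
Qed.

Let scaleDr : right_distributive L0_scale +%R.
Proof.
move=> a f g; apply/L0P; apply: filterS
  (filterI (scaleE a (f + g)) (filterI (addE f g) (filterI (addE (L0_scale a f) (L0_scale a g)) (filterI (scaleE a f) (scaleE a g))))) =>
  t [e1 [e2 [e3 [e4 e5]]]] _.
by rewrite e1// e2// e3// e4// e5// mulrDr.
Qed.

Let scaleDl f : {morph L0_scale^~ f : a b / a + b}.
Proof.
move=> a b; apply/L0P; apply: filterS
  (filterI (scaleE (a + b) f) (filterI (addE (L0_scale a f) (L0_scale b f)) (filterI (scaleE a f) (scaleE b f)))) =>
  t [e1 [e2 [e3 e4]]] _.
by rewrite e1// e2// e3// e4// mulrDl.
Qed.

HB.instance Definition _ := GRing.Zmodule_isLmodule.Build R[i] (L0 P)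
  scaleA scale1 scaleDr scaleDl.

Let scaleAl (a : R[i]) f g : a *: (f * g) = (a *: f) * g.
Proof.
apply/L0P; apply: filterS
  (filterI (scaleE a (f * g)) (filterI (mulE f g) (filterI (mulE (a *: f) g) (scaleE a f)))) =>
  t [e1 [e2 [e3 e4]]] _.
by rewrite e1// e2// e3// e4// mulrA.
Qed.

HB.instance Definition _ := GRing.Lmodule_isLalgebra.Build R[i] (L0 P) scaleAl.
HB.instance Definition _ := GRing.Lalgebra_isComAlgebra.Build R[i] (L0 P).

Lemma L0_addE f g : L0_fun (f + g) = (fun t => f t + g t) %[ae P].
Proof. exact: addE. Qed.

Lemma L0_mulE f g : L0_fun (f * g) = (fun t => f t * g t) %[ae P].
Proof. exact: mulE. Qed.

Lemma L0_scaleE (c : R[i]) f : L0_fun (c *: f) = (fun t => c * f t) %[ae P].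
Proof. exact: scaleE. Qed.

Lemma L0_oppE f : L0_fun (- f) = (fun t => - f t) %[ae P].
Proof. by apply: filterS
  (scaleE (-1) f) =>
  t + _ => ->//; rewrite mulN1r. Qed.

Lemma L0_oneE : L0_fun 1 = (fun=> 1) %[ae P].
Proof. exact: constE. Qed.

Lemma L0_zeroE : L0_fun 0 = (fun=> 0) %[ae P].
Proof. exact: constE. Qed.

End L0.

Section log_space.
Context {d} {T : measurableType d} {R : realType} {P : probability T R}.
Implicit Types (p : R) (w : T -> R) (f g h : L0 P).

Definition logmod w f (t : T) : R := ln (1 + Normc.normc (f t) * w t).

(* (\int (log (1 + |f| w))^p)^(1/p), for 0 < p; it need not be a norm. *)
Definition lognorm p w f : \bar R := 'N[P]_p%:E[EFin \o logmod w f]%E.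

Lemma lognormE p w f : p != 0 ->
  (lognorm p w f `^ p = \int[P]_t ((`|logmod w f t| `^ p)%:E))%E.
Proof. by move=> p0; rewrite /lognorm poweR_Lnorm. Qed.

(* The class L^w_p; L_p is the case w = 1. *)
Definition logLw p w : set (L0 P) := [set f | (lognorm p w f < +oo)%E].

(* [fine] sends +oo to 0, but this does not hide anything: if logrho p w is a
   metric (dist_eq0 below) on a set of classes, then lognorm p w is finite on
   all differences, since an infinite value would give logrho p w f g = 0 with
   f <> g. *)
Definition logrho p w f g : R := (fine (lognorm p w (f - g))) `^ Num.min p 1.

Local Notation one := (fun=> 1 : R).

Lemma logmod1_ge0 f t : 0 <= logmod one f t.
Proof. 
rewrite /logmod mulr1 ln_ge0// lerDl.
by case: (f t) => a b; exact: sqrtr_ge0.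
Qed.

Lemma measurable_logmod w f :
  measurable_fun setT w -> measurable_fun setT (logmod w f).
Proof.
move=> mw; apply: (measurableT_comp (@measurable_ln R)).
apply: measurable_funD => //; apply: measurable_funM => //.
exact/measurable_normc/measurable_L0.
Qed.

Lemma logLw1E p f : 0 < p -> logLw p one f <->
  (\int[P]_t ((logmod one f t `^ p)%:E) < +oo)%E.
Proof.
move=> p0; have pn0 : p != 0 by rewrite gt_eqF.
have -> : (\int[P]_t ((logmod one f t `^ p)%:E) = lognorm p one f `^ p)%E.
  rewrite lognormE//; apply: eq_integral => t _.
  by rewrite ger0_norm// logmod1_ge0.
split; first exact: poweR_lty.
exact: lty_poweRy.
Qed.

Let bound p f g h : 0 < p ->
  (\forall t \ae P, logmod one h t <= logmod one f t + logmod one g t) ->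
  logLw p one f -> logLw p one g -> logLw p one h.
Proof.
move=> p0 hfg /(logLw1E _ p0) ff /(logLw1E _ p0) fg; apply/(logLw1E _ p0).
have m u : measurable_fun setT (fun t => (logmod one u t `^ p)%:E).
  apply/measurable_EFinP; apply: (measurableT_comp (@measurable_powR R p)).
  exact: measurable_logmod.
pose F t : \bar R :=
  ((2 `^ p)%:E * ((logmod one f t `^ p)%:E + (logmod one g t `^ p)%:E))%E.
apply: (@le_lt_trans _ _ (\int[P]_t F t)%E).
  apply: ae_ge0_le_integral => //.
  - by move=> t _; rewrite lee_fin powR_ge0.
  - by move=> t _; rewrite /F -EFinD -EFinM lee_fin mulr_ge0 ?addr_ge0 ?powR_ge0.
  - by apply: emeasurable_funM => //; exact: emeasurable_funD.
  apply: filterS hfg => t htfg _; rewrite /F -EFinD -EFinM lee_fin.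
  have a0 := logmod1_ge0 f t; have b0 := logmod1_ge0 g t.
  move: (logmod one f t) (logmod one g t) a0 b0 htfg => a b a0 b0 hab.
  apply: (@le_trans _ _ ((2 * Num.max a b) `^ p)).
    apply: ge0_ler_powR; rewrite ?nnegrE ?logmod1_ge0 ?(ltW p0)//.
      by rewrite mulr_ge0// le_max a0.
    by rewrite (le_trans hab)// mulr2n mulrDl mul1r lerD// le_max lexx// orbT.
  rewrite powRM ?le_max ?a0// ler_wpM2l ?powR_ge0//.
  by case: (leP a b) => _; rewrite ?lerDl ?lerDr ?powR_ge0.
rewrite ge0_integralZl//; last 2 first.
- exact: emeasurable_funD.
- by move=> t _; rewrite -EFinD lee_fin addr_ge0 ?powR_ge0.
rewrite ge0_integralD//; last 2 first.
- by move=> t _; rewrite lee_fin powR_ge0.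
- by move=> t _; rewrite lee_fin powR_ge0.
apply: lte_mul_pinfty; [by rewrite lee_fin powR_ge0|by []|].
by apply: lte_add_pinfty; [exact: ff|exact: fg].
Qed.

Let logLw_const p (c : R[i]) : 0 < p -> logLw p one (c *: 1).
Proof.
move=> p0; apply/(logLw1E _ p0).
suff -> : (\int[P]_t ((logmod one (c *: 1) t `^ p)%:E) =
    \int[P]_(t in setT) (ln (1 + Normc.normc c) `^ p)%:E)%E.
  rewrite integral_cst//=.
  by rewrite [X in (_ * X)%E](@probability_setT _ _ _ P) mule1 ltry.
apply: ae_eq_integral => //.
- apply/measurable_EFinP; apply: (measurableT_comp (@measurable_powR R p)).
  exact: measurable_logmod.
apply: filterS (filterI (L0_scaleE c (1 : L0 P)) (@L0_oneE _ T R P)).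
move=> t [e1 e2] _.
by rewrite /logmod e1// e2// !mulr1.
Qed.

Let logLw_add p f g : 0 < p ->
  logLw p one f -> logLw p one g -> logLw p one (f + g).
Proof.
move=> p0; apply: bound => //.
apply: filterS (L0_addE f g) => t fgE; rewrite /logmod fgE// !mulr1.
have n0 z : 0 <= Normc.normc z :> R by case: z => a b; exact: sqrtr_ge0.
have n1 z : 0 < 1 + Normc.normc z :> R by rewrite ltr_wpDr.
rewrite -lnM ?posrE ?n1// ler_ln ?posrE ?mulr_gt0//.
rewrite mulrDl mul1r mulrDr mulr1 -!addrA lerD2l.
rewrite (le_trans (le_normcD _ _))//.
by rewrite addrA [leLHS]addrC lerDl mulr_ge0.
Qed.

Let logLw_mul p f g : 0 < p ->
  logLw p one f -> logLw p one g -> logLw p one (f * g).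
Proof.
move=> p0; apply: bound => //.
apply: filterS (L0_mulE f g) => t fgE; rewrite /logmod fgE// !mulr1.
have n0 z : 0 <= Normc.normc z :> R by case: z => a b; exact: sqrtr_ge0.
have n1 z : 0 < 1 + Normc.normc z :> R by rewrite ltr_wpDr.
rewrite -lnM ?posrE ?n1// ler_ln ?posrE ?mulr_gt0//.
rewrite Normc.normcM mulrDl mul1r mulrDr mulr1 -!addrA lerD2l.
by rewrite addrA lerDr addr_ge0.
Qed.

Definition logL_pred p (p0 : 0 < p) : {pred L0 P} := mem (logLw p one).

Lemma logL_subalg_closed p (p0 : 0 < p) : GRing.subalg_closed (logL_pred p0).
Proof.
have scl (c : R[i]) f : logLw p one f -> logLw p one (c *: f).
  by move=> ff; rewrite -[f]mul1r scalerAl; apply: logLw_mul => //;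
    exact: logLw_const.
split.
- apply/mem_set; rewrite -(scale1r (1 : L0 P)).
  exact: (logLw_const 1 p0).
- move=> c f g /set_mem ff /set_mem fg; apply/mem_set.
  by apply: logLw_add => //; exact: scl.
- by move=> f g /set_mem ff /set_mem fg; apply/mem_set; exact: logLw_mul.
Qed.

HB.instance Definition _ p (p0 : 0 < p) :=
  GRing.isSubalgClosed.Build R[i] (L0 P) (logL_pred p0)
    (GRing.subalg_closed_semi (logL_subalg_closed p0)).

End log_space.

Section logL.
Context {d} {T : measurableType d} {R : realType}.
Variables (P : probability T R) (p : R) (p0 : 0 < p).

(* The algebra L_p, as a subalgebra of L0 P. The proof of 0 < p is a parameter
   because closure under addition depends on it. *)
Record logL : Type := LogL {
  logL_val :> L0 P ;
  logL_valP : logL_val \in logL_pred p0 }.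

HB.instance Definition _ := [isSub for logL_val].
HB.instance Definition _ := [Choice of logL by <:].
HB.instance Definition _ :=
  [SubChoice_isSubComNzRing of logL by <:].
HB.instance Definition _ :=
  GRing.SubZmodule_isSubLmodule.Build R[i] (L0 P) (logL_pred p0) logL
    (GRing.subsemialg_closedZ
      (GRing.subalg_closed_semi (logL_subalg_closed p0))).
HB.instance Definition _ := GRing.SubNzRing_SubLmodule_isSubLalgebra.Build
  R[i] (L0 P) (logL_pred p0) logL.
HB.instance Definition _ := GRing.SubLalgebra_isSubAlgebra.Build
  R[i] (L0 P) (logL_pred p0) logL.
End logL.

Record is_metric (R : realType) (A : Type) (dist : A -> A -> R) : Prop := {
  distxx : forall x, dist x x = 0 ;
  dist_eq0 : forall x y, dist x y = 0 -> x = y ;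
  dist_sym : forall x y, dist x y = dist y x ;
  dist_triangle : forall y x z, dist x z <= dist x y + dist y z }.

(* A copy of A with the metric structure, hence the topology, of dist. *)
Definition metrized (R : realType) (A : Type) (dist : A -> A -> R)
  (dm : is_metric dist) : Type := A.

HB.instance Definition _ (R : realType) (A : choiceType) (dist : A -> A -> R)
  (dm : is_metric dist) := Choice.on (metrized dm).
HB.instance Definition _ (R : realType) (A : choiceType) (dist : A -> A -> R)
  (dm : is_metric dist) := isMetric.Build R (metrized dm)
    (distxx dm) (dist_eq0 dm) (dist_sym dm) (dist_triangle dm).
HB.instance Definition _ (R : realType) (K : numFieldType) (A : algType K)
  (dist : A -> A -> R) (dm : is_metric dist) :=
  GRing.Algebra.on (metrized dm).

Record is_F_algebra (R : realType) (K : numFieldType) (A : algType K)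
    (dist : A -> A -> R) : Prop := {
  F_metric : is_metric dist ;
  F_invariant : forall a x y, dist (x + a) (y + a) = dist x y ;
  F_complete : forall u : nat -> metrized F_metric,
    cauchy (u @ \oo) -> exists l : metrized F_metric, u @ \oo --> l ;
  F_add_continuous : continuous
    (fun z : metrized F_metric * metrized F_metric => z.1 + z.2) ;
  F_scale_continuous : continuous
    (fun z : K^o * metrized F_metric => z.1 *: z.2) ;
  F_mul_continuous : continuous
    (fun z : metrized F_metric * metrized F_metric => z.1 * z.2) }.

Definition same_topology (R : realType) (A : choiceType)
    (dist1 dist2 : A -> A -> R) : Prop :=
  exists (m1 : is_metric dist1) (m2 : is_metric dist2),
    forall U : set A, @open (metrized m1) U <-> @open (metrized m2) U.

Record is_weight d (T : measurableType d) (R : realType) (P : probability T R)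
    (w : T -> R) : Prop := {
  weight_measurable : measurable_fun setT w ;
  weight_ge0 : forall t, 0 <= w t ;
  weight_gt0 : \forall t \ae P, 0 < w t }.

(* Main.v *)
Require Import Defs.
From HB Require Import structures.
From mathcomp Require Import all_boot all_order all_algebra.
From mathcomp Require Import complex.
From mathcomp Require Import all_classical all_reals all_analysis.
From mathcomp Require Import measurable_realfun ring lra.
Set Implicit Arguments.
Unset Strict Implicit.
Unset Printing Implicit Defensive.
Import Order.TTheory GRing.Theory Num.Theory.
Import numFieldTopology.Exports numFieldNormedType.Exports.
Local Open Scope classical_set_scope.
Local Open Scope ring_scope.

(* Since log (1 + w) <= log 2 + |log w| and log (1 + 1/w) <= log 2 + |log w|,
   both w and 1/w belong to L_p, so w is a unit of the algebra L_p, and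
   rho^w_p (f, g) = rho_p (w f, w g). Multiplication by a unit is a linear
   homeomorphism of an F-algebra, so everything reduces to w = 1.
   For w = 1, log (1 + |f g|) and log (1 + |f + g|) are both at most
   log (1 + |f|) + log (1 + |g|), which gives the triangle inequality and the
   continuity of the product at (0, 0). For h -> a h with a fixed, one uses
   log (1 + |a h|) <= k log (1 + |h|) where |a| <= k, and the subadditive bound
   on the remaining set, where log (1 + |a|) has small norm by dominated
   convergence. Completeness is the Riesz-Fischer argument: along a subsequence
   the differences are a.e. summable, and Fatou's lemma identifies the limit. *)

(** * Algebras with a translation invariant metric *)

(** All conditions are stated at 0, where they can be checked by direct estimates; translation
    invariance then spreads them to every point. Multiplication by a scalar [c] is treated as
    multiplication by the element [c%:A], so [F_norm_alg] only has to control small scalars. *)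
Record F_norm (R : realType) (K : numFieldType) (A : algType K)
    (N : A -> R) : Prop := {
  F_norm0 : N 0 = 0 ;
  F_norm_eq0 : forall x, N x = 0 -> x = 0 ;
  F_normN : forall x, N (- x) = N x ;
  F_normD : forall x y, N (x + y) <= N x + N y ;
  F_normM : forall e, 0 < e -> exists2 d, 0 < d &
    forall x y, N x < d -> N y < d -> N (x * y) < e ;
  F_normMl : forall a e, 0 < e -> exists2 d, 0 < d &
    forall x, N x < d -> N (a * x) < e ;
  F_normMr : forall a e, 0 < e -> exists2 d, 0 < d &
    forall x, N x < d -> N (x * a) < e ;
  F_norm_alg : forall e, 0 < e -> exists2 d : K, 0 < d &
    forall c : K, `|c| < d -> N c%:A < e ;
  F_norm_complete : forall u : nat -> A,
    (forall e, 0 < e -> exists n0, forall m n,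
      (n0 <= m)%N -> (n0 <= n)%N -> N (u m - u n) < e) ->
    exists l, forall e, 0 < e -> exists n0, forall n,
      (n0 <= n)%N -> N (l - u n) < e }.

Section F_norm_algebra.
Context {R : realType} {K : numFieldType} {A : algType K} {N : A -> R}.
Hypothesis FN : F_norm N.

Lemma F_norm_metric : is_metric (fun x y : A => N (x - y)).
Proof.
split => [x|x y /(F_norm_eq0 FN)/eqP|x y|y x z].
- by rewrite subrr (F_norm0 FN).
- by rewrite subr_eq0 => /eqP.
- by rewrite -(F_normN FN) opprB.
- by rewrite -(subrKA y); exact: F_normD.
Qed.

(** The difference of products splits as a b - x y = (a - x) b + a (b - y) - (a - x) (b - y). The
    three terms are made small by [F_normMr], [F_normMl] and [F_normM] respectively, each with a
    third of [e]. *)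
Lemma F_norm_mul_near (a b : A) (e : R) : 0 < e -> exists2 d, 0 < d &
  forall x y, N (a - x) < d -> N (b - y) < d -> N (a * b - x * y) < e.
Proof.
move=> e0; have e3 : 0 < e / 3 by rewrite divr_gt0.
have [d1 d10 h1] := F_normM FN e3.
have [d2 d20 h2] := F_normMl FN a e3.
have [d3 d30 h3] := F_normMr FN b e3.
exists (Num.min d1 (Num.min d2 d3)); first by rewrite !lt_min d10 d20.
move=> x y; rewrite !lt_min => /and3P[x1 x2 x3] /and3P[y1 y2 y3].
have -> : a * b - x * y = (a - x) * b + (a * (b - y) - (a - x) * (b - y)).
  by rewrite -mulrBl subKr mulrBl mulrBr addrA subrK.
rewrite (_ : e = e / 3 + (e / 3 + e / 3)); last by lra.
apply: le_lt_trans (F_normD FN _ _) _; apply: ltrD; first exact: h3.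
apply: le_lt_trans (F_normD FN _ _) _; apply: ltrD; first exact: h2.
by rewrite (F_normN FN) h1.
Qed.

Lemma F_norm_cvg (u : nat -> metrized F_norm_metric)
    (l : metrized F_norm_metric) : u @ \oo --> l <->
  forall e, 0 < e -> exists n0, forall n, (n0 <= n)%N -> N (l - u n : A) < e.
Proof.
split=> [/cvg_ballP ul e /ul [n0 _ h]|h].
  by exists n0 => n /h.
by apply/cvg_ballP => e /h [n0 n0h]; exists n0.
Qed.

Lemma F_norm_continuousD : continuous
  (fun z : metrized F_norm_metric * metrized F_norm_metric => z.1 + z.2).
Proof.
move=> -[a b]; apply/cvg_ballP => e e0.
have e2 : 0 < e / 2 by rewrite divr_gt0.
exists (ball a (e / 2), ball b (e / 2)); first by split; exact: nbhsx_ballx.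
move=> [x y] /= [ax bdy]; rewrite [e]splitr.
rewrite (_ : ball _ _ _ = (N ((a + b : A) - (x + y)) < e / 2 + e / 2))//.
rewrite opprD addrACA.
by apply: le_lt_trans (F_normD FN _ _) _; exact: ltrD.
Qed.

Lemma F_norm_continuousM : continuous
  (fun z : metrized F_norm_metric * metrized F_norm_metric => z.1 * z.2).
Proof.
move=> -[a b]; apply/cvg_ballP => e e0.
have [d d0 h] := F_norm_mul_near a b e0.
exists (ball a d, ball b d); first by split; exact: nbhsx_ballx.
by move=> [x y] /= [ax bdy]; exact: h.
Qed.

Lemma F_norm_continuousZ : continuous
  (fun z : K^o * metrized F_norm_metric => z.1 *: z.2).
Proof.
move=> -[a b]; apply/cvg_ballP => e e0.
(* Scaling by [a] is multiplication by [a%:A], so joint continuity of the product applies;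
   [F_norm_alg] makes [a%:A - x%:A] small. *)
have [d d0 h] := F_norm_mul_near a%:A b e0.
have [r r0 hr] := F_norm_alg FN d0.
exists (ball a r, ball b d); first by split; exact: nbhsx_ballx.
move=> [x y] /= [ax bdy].
rewrite (_ : ball _ _ _ = (N (a *: (b : A) - x *: (y : A)) < e))//.
have := h x%:A y _ bdy; rewrite -!scalerAl !mul1r; apply.
by rewrite -scalerBl; exact: hr.
Qed.

Lemma F_norm_F_algebra : is_F_algebra (fun x y : A => N (x - y)).
Proof.
exists F_norm_metric.
- by move=> a x y; rewrite opprD addrACA subrr addr0.
- move=> u /cauchy_ballP uc.
  have [|l hl] := F_norm_complete FN (u := u).
    move=> e /uc [[U V] /= [[n1 _ U1] [n2 _ V2]] UV].
    exists (maxn n1 n2) => m n; rewrite !geq_max => /andP[m1 m2] /andP[n1' n2'].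
    by apply: (UV (u m, u n)); split; [exact: U1|exact: V2].
  by exists l; exact/F_norm_cvg.
- exact: F_norm_continuousD.
- exact: F_norm_continuousZ.
- exact: F_norm_continuousM.
Qed.

End F_norm_algebra.

(** * Changing the metric by multiplication with a unit *)

Section F_norm_unit.
Context {R : realType} {K : numFieldType} {A : algType K} {N : A -> R}.
Hypothesis FN : F_norm N.
Variables (u v : A).
Hypotheses (uv : u * v = 1) (vu : v * u = 1).

(** Multiplication by [u] is a linear bijection with inverse multiplication by [v], and both are
    continuous at 0, so each condition is carried over from [N]. *)
Lemma F_norm_unit : F_norm (fun x => N (u * x)).
Proof.
split => /=.
- by rewrite mulr0 (F_norm0 FN).
- by move=> x /(F_norm_eq0 FN) ux0; rewrite -[x]mul1r -vu -mulrA ux0 mulr0.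
- by move=> x; rewrite mulrN (F_normN FN).
- by move=> x y; rewrite mulrDr; exact: F_normD.
- move=> e e0.
  have [d d0 h] := F_normM FN e0; have [r r0 hr] := F_normMr FN v d0.
  exists (Num.min d r); first by rewrite lt_min d0.
  move=> x y; rewrite !lt_min => /andP[_ xr] /andP[yd _].
  (* Inserting [v * u = 1] between the factors expresses the product through [u * x] and [u * y],
     the only elements whose size is known; the extra factor [v] is absorbed by the radius [r]. *)
  have -> : u * (x * y) = (u * x * v) * (u * y).
    by rewrite -[in RHS]mulrA (mulrA v) vu mul1r mulrA.
  by apply: h => //; exact: hr.
- move=> a e e0; have [d d0 h] := F_normMl FN (u * a * v) e0.
  exists d => // x /h.
  by rewrite -[X in N X]mulrA (mulrA v) vu mul1r mulrA.
- move=> a e e0; have [d d0 h] := F_normMr FN a e0.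
  by exists d => // x /h; rewrite -mulrA.
- move=> e e0; have [d d0 h] := F_normMl FN u e0.
  have [r r0 hr] := F_norm_alg FN d0.
  by exists r => // c /hr /h.
- move=> x xc; have [|l hl] := F_norm_complete FN (u := fun n => u * x n).
    move=> e /xc [n0 h]; exists n0 => m n /h /[apply].
    by rewrite mulrBr.
  (* The sequence [u * x n] converges to [l], so the limit of [x] is obtained by undoing the
     multiplication. *)
  exists (v * l) => e /hl [n0 h]; exists n0 => n /h.
  by rewrite mulrBr mulrA uv mul1r.
Qed.

(** Continuity at 0 of multiplication by [u] fits an [N]-ball inside each ball of the new metric;
    continuity of multiplication by [v] gives the reverse. *)
Lemma F_norm_unit_topology :
  same_topology (fun x y : A => N (u * (x - y))) (fun x y : A => N (x - y)).
Proof.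
exists (F_norm_metric F_norm_unit), (F_norm_metric FN) => U.
rewrite !openE; split => oU x /oU /nbhs_ballP [e /= e0 eU]; apply/nbhs_ballP.
- have [d d0 h] := F_normMl FN u e0.
  by exists d => // y; move=> /h xy; exact: eU.
- have [d d0 h] := F_normMl FN v e0.
  exists d => // y xy; apply: eU; apply: (_ : N (_ - _) < e).
  by have := h _ xy; rewrite mulrA vu mul1r.
Qed.

End F_norm_unit.

(** * Powers with a real exponent *)

Lemma powR_cvg (R : realType) (p : R) (p0 : 0 < p) (x : nat -> R) (a : R) :
  (forall n, 0 <= x n) -> x @ \oo --> a -> x n `^ p @[n --> \oo] --> a `^ p.
Proof.
move=> x0 xa.
have a0 : 0 <= a.
  rewrite -(cvg_lim (@Rhausdorff R) xa).
  by apply: limr_ge; [apply/cvg_ex; exists a|exact: nearW].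
have [az|an0] := eqVneq a 0; last first.
  have ac : {for a, continuous (fun y : R => y `^ p)}.
    apply/differentiable_continuous/derivable1_diffP/derivable_powR.
    by rewrite in_itv/= andbT lt_neqAle eq_sym an0.
  exact: (@continuous_cvg _ _ _ _ _ x _ _ ac xa).
move: xa; rewrite az => /cvgrPdist_lt xa.
rewrite powR0 ?gt_eqF//; apply/cvgrPdist_lt => e e0.
have e1 : 0 < e `^ p^-1 by rewrite powR_gt0.
have := xa _ e1.
apply: filterS => n; rewrite !sub0r !normrN !ger0_norm ?powR_ge0// => xe.
have := gt0_ltr_powR p0 _ _ xe; rewrite -powRrM mulVf ?gt_eqF// powRr1 ?ltW//.
by apply; rewrite nnegrE// ltW.
Qed.

(** With s = a + b, each c in [0, s] satisfies c / s <= (c / s)^p because p <= 1. Multiplying by s^p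
    and adding the cases c = a and c = b gives the bound. *)
Lemma powR_subadditive (R : realType) (p a b : R) : 0 < p <= 1 ->
  0 <= a -> 0 <= b -> (a + b) `^ p <= a `^ p + b `^ p.
Proof.
move=> /andP[p0 p1] a0 b0.
have [s0|s0] := eqVneq (a + b) 0.
  by rewrite s0 powR0 ?gt_eqF// addr_ge0// powR_ge0.
have sgt0 : 0 < a + b by rewrite lt_neqAle eq_sym s0 addr_ge0.
have key c : 0 <= c <= a + b -> c / (a + b) * (a + b) `^ p <= c `^ p.
  move=> /andP[c0 cab]; have [->|cn0] := eqVneq c 0.
    by rewrite !mul0r powR_ge0.
  have -> : c `^ p = (c / (a + b)) `^ p * (a + b) `^ p.
    by rewrite -powRM ?divr_ge0 ?(ltW sgt0)// divfK.
  rewrite ler_wpM2r ?powR_ge0// ger1_powR//.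
  apply/andP; split; last by rewrite ler_pdivrMr// mul1r.
  by rewrite divr_gt0// lt_neqAle eq_sym cn0.
have -> : (a + b) `^ p = a / (a + b) * (a + b) `^ p + b / (a + b) * (a + b) `^ p.
  by rewrite -mulrDl -mulrDl divff// mul1r.
by rewrite lerD// key// ?a0 ?b0 ?lerDl ?lerDr.
Qed.

(** * The translation invariant distance to 0 in real L^p, for every p > 0 *)

Section lpdist.
Context d (T : measurableType d) (R : realType).
Variables (mu : {measure set T -> \bar R}) (p : R) (p0 : 0 < p).
Implicit Types u v : T -> R.

Local Notation expo := (Num.min p 1)%R.

(** This is the L^p norm when p >= 1 and the integral of |u|^p when p <= 1; the exponent is the one
    that makes the triangle inequality hold in both ranges. *)
Definition lpdist u : \bar R :=
  ('N[mu]_p%:E [EFin \o u] `^ expo)%E.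

Local Notation pint u := (\int[mu]_t (`|u t| `^ p)%:E)%E.

Let pn0 : p != 0. Proof. by rewrite gt_eqF. Qed.

Let min0 : 0 < Num.min p 1. Proof. by rewrite lt_min p0 ltr01. Qed.

Let r0 : 0 < expo / p. Proof. by rewrite divr_gt0. Qed.

Let pint_ge0 u : (0 <= pint u)%E.
Proof. by apply: integral_ge0 => t _; rewrite lee_fin powR_ge0. Qed.

Let measurable_pow u : measurable_fun setT u ->
  measurable_fun setT (fun t => (`|u t| `^ p)%:E).
Proof.
move=> mu'; apply/measurable_EFinP; apply: (measurableT_comp (@measurable_powR R p)).
exact: measurableT_comp.
Qed.

Let lpdistE u : lpdist u = (pint u `^ (expo / p))%E.
Proof. by rewrite /lpdist unlock /= -poweRrM mulrC. Qed.

(** Raising to the inverse exponent turns a bound on the distance into a bound on the plain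
    integral, to which the convergence theorems apply. *)
Let lpdist_leE u (c : \bar R) : (0 <= c)%E ->
  (lpdist u <= c)%E = (pint u <= c `^ (expo / p)^-1%R)%E.
Proof.
move=> c0; rewrite lpdistE.
have h (x y : \bar R) (r : R) : 0 < r -> (0 <= x -> 0 <= y -> x <= y -> x `^ r <= y `^ r)%E.
  by move=> r1 x1 y1 xy; apply: gt0_ler_poweR; rewrite ?in_itv/= ?x1 ?y1 ?leey ?(ltW r1).
apply/idP/idP => [xc|xc].
- have /h/(_ (poweR_ge0 _ _) c0 xc) : 0 < (expo / p)^-1 by rewrite invr_gt0.
  by rewrite -poweRrM mulfV ?gt_eqF// poweRe1.
- have := h _ _ _ r0 (pint_ge0 u) (poweR_ge0 _ _) xc.
  by rewrite -poweRrM mulVf ?gt_eqF// poweRe1.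
Qed.

Lemma lpdist_ge0 u : (0 <= lpdist u)%E.
Proof. exact: poweR_ge0. Qed.

Lemma le_lpdist u v : measurable_fun setT u -> measurable_fun setT v ->
  (\forall t \ae mu, `|u t| <= `|v t|) -> (lpdist u <= lpdist v)%E.
Proof.
move=> mu' mv uv; rewrite lpdist_leE ?lpdist_ge0// lpdistE -poweRrM.
rewrite mulfV ?gt_eqF// poweRe1//.
apply: ae_ge0_le_integral => //; [exact: measurable_pow..|].
apply: filterS uv => t uvt _.
by rewrite lee_fin ge0_ler_powR ?nnegrE// ltW.
Qed.

Lemma lpdist0 : lpdist (fun=> 0) = 0%E.
Proof. by rewrite /lpdist [X in (X `^ _)%E]Lnorm0 ?poweR0r ?gt_eqF. Qed.

(** For p >= 1 this is Minkowski's inequality; for p < 1 the subadditivity of the power is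
    integrated. *)
Lemma lpdistD u v : measurable_fun setT u -> measurable_fun setT v ->
  (lpdist (fun t => (u t + v t)%R) <= lpdist u + lpdist v)%E.
Proof.
move=> mu' mv; rewrite /lpdist.
have [p1|p1] := leP 1 p.
  by rewrite !poweRe1 ?Lnorm_ge0//; exact: minkowski_EFin.
rewrite !poweR_Lnorm//= -ge0_integralD//; [|exact: measurable_pow..].
apply: ge0_le_integral => //.
- by apply: measurable_pow; exact: measurable_funD.
- by apply: emeasurable_funD; exact: measurable_pow.
move=> t _; rewrite lee_fin.
have p01 : 0 < p <= 1 by rewrite p0 ltW.
apply: (le_trans _ (powR_subadditive p01 (normr_ge0 _) (normr_ge0 _))).
by apply: ge0_ler_powR; rewrite ?nnegrE ?(ltW p0) ?addr_ge0//= ler_normD.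
Qed.

Lemma lpdist_sum (n : nat) (u : nat -> T -> R) :
  (forall i, measurable_fun setT (u i)) ->
  (lpdist (fun t => (\sum_(i < n) u i t)%R) <= \sum_(i < n) lpdist (u i))%E.
Proof.
move=> mu'; elim: n => [|n ih].
  rewrite big_ord0 (_ : (fun t => _) = fun=> 0) ?lpdist0//.
  by apply/funext => t; rewrite big_ord0.
rewrite big_ord_recr/= (_ : (fun t => _) = fun t => \sum_(i < n) u i t + u n t); last first.
  by apply/funext => t; rewrite big_ord_recr.
apply: (le_trans (lpdistD _ _)) => //; first exact: measurable_sum.
exact: leeD.
Qed.

Lemma lpdist_eq0 u : measurable_fun setT u -> lpdist u = 0%E ->
  u = (fun=> 0) %[ae mu].
Proof.
move=> mu' /poweR_eq0_eq0 => /(_ (Lnorm_ge0 _ _ _)) /Lnorm_eq0_eq0.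
rewrite lte_fin => /(_ _ p0).
by move=> h; apply: filterS (h _) => [t /= + I|]; [move=> /(_ I) []|exact/measurable_EFinP].
Qed.

(** Fatou's lemma for |u_n|^p: closed balls of the distance are stable under a.e. limits. *)
Lemma lpdist_fatou (u_ : nat -> T -> R) u (c : \bar R) :
  (forall n, measurable_fun setT (u_ n)) -> measurable_fun setT u ->
  (\forall t \ae mu, u_ n t @[n --> \oo] --> u t) ->
  (\forall n \near \oo, (lpdist (u_ n) <= c)%E) -> (lpdist u <= c)%E.
Proof.
move=> mu_ mu' cvu [n0 _ uc].
have c0 : (0 <= c)%E by apply: le_trans (uc n0 (leqnn _)); exact: lpdist_ge0.
rewrite lpdist_leE//.
(* The shift by [n0] makes the eventual bound hold for every index. *)
pose f n t := (`|u_ (n + n0)%N t| `^ p)%:E.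
apply: (@le_trans _ _ (\int[mu]_t limn_einf (f ^~ t))%E).
  apply: ae_ge0_le_integral => //.
  - exact: measurable_pow.
  - move=> t _; rewrite limn_einf_lim; apply: lime_ge; first exact: is_cvg_einfs.
    apply: nearW => n; apply: le_ereal_inf_tmp => _ [m /= _ <-].
    by rewrite lee_fin powR_ge0.
  - rewrite /limn_einf; apply: measurableT_comp => //.
    apply: measurable_fun_limn_esup => n.
    by apply: measurableT_comp => //; exact: measurable_pow.
  - apply: filterS cvu => t ut _.
    have /cvg_limn_einf_sup[-> _] // : f n t @[n --> \oo] --> (`|u t| `^ p)%:E.
    apply: cvg_EFin; first by apply: nearW.
    apply: powR_cvg => //; apply: cvg_norm.
    by rewrite (cvg_shiftn n0 (u_ ^~ t)).
apply: le_trans (fatou _ _ _ _) _ => //.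
- by move=> n; exact: measurable_pow.
- by move=> n t _; rewrite lee_fin powR_ge0.
rewrite limn_einf_lim; apply: lime_le; first exact: is_cvg_einfs.
apply: nearW => n; apply: (@le_trans _ _ (\int[mu]_t f n t)%E).
  by apply: ereal_inf_lbound; exists n => /=.
by rewrite -lpdist_leE//; apply: uc => /=; exact: leq_addl.
Qed.

(** At each point the truncated tail vanishes as soon as [n] exceeds |u t|, and |u|^p dominates its
    p-th power, so dominated convergence sends the integrals to 0. *)
Lemma lpdist_tail u (e : R) : measurable_fun setT u -> (lpdist u < +oo)%E ->
  0 < e -> exists n : nat,
    (lpdist (fun t => if (`|u t| <= n%:R)%R then 0%R else u t) < e%:E)%E.
Proof.
move=> mu' ufin e0.
pose f n t := (`|if `|u t| <= n%:R then 0 else u t| `^ p)%:E.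
have mtail n : measurable_fun setT (fun t => if (`|u t| <= n%:R)%R then 0 else u t).
  apply: measurable_fun_ifT => //; apply: measurable_fun_ler => //.
  exact: measurableT_comp.
have [] := @dominated_convergence _ T R mu setT measurableT f (fun=> 0%E)
   (fun t => (`|u t| `^ p)%:E).
- by move=> n; exact: measurable_pow.
- by [].
- apply: nearW => t _; apply: cvg_near_cst.
  have [n un] : exists n : nat, `|u t| <= n%:R.
    by exists (Num.Def.archi_bound `|u t|); rewrite ltW// archi_boundP.
  exists n => // m /= nm; rewrite /f (le_trans un) ?ler_nat// normr0 powR0//.
- apply/integrableP; split; first exact: measurable_pow.
  rewrite (_ : (\int[mu]_x `|_|)%E = pint u); last first.
    by apply: eq_integral => t _; rewrite gee0_abs// lee_fin powR_ge0.
  apply: (lty_poweRy (r := (expo / p)%R)); first by rewrite gt_eqF.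
  by rewrite -lpdistE.
- apply: nearW => t n _; rewrite /f gee0_abs ?lee_fin ?powR_ge0//.
  by case: ifP => // _; rewrite normr0 powR0 ?powR_ge0.
move=> _ _; rewrite integral0 => h.
(* The value of the integral of the p-th power at which the distance equals [e]. *)
have e1 : (0 < (e%:E `^ (expo / p)^-1%R))%E.
  by rewrite poweR_gt0.
have nb : nbhs (0 : \bar R)%E [set x | (x < e%:E `^ (expo / p)^-1%R)%E].
  by apply: open_nbhs_nbhs; split; [exact: open_ereal_lt_ereal|exact: e1].
have [n _ /(_ n (leqnn n)) hn] := h _ nb.
exists n; rewrite ltNge; apply/negP => le.
have : (\int[mu]_x f n x < e%:E `^ (expo / p)^-1%R)%E by exact: hn.
apply/negP; rewrite -leNgt.
have -> : (\int[mu]_x f n x)%E = (lpdist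
    (fun t => if (`|u t| <= n%:R)%R then 0%R else u t) `^ (expo / p)^-1%R)%E.
  by rewrite lpdistE -poweRrM mulfV ?gt_eqF// poweRe1.
apply: gt0_ler_poweR le.
- by rewrite invr_ge0 ltW.
- by rewrite in_itv/= leey lee_fin ltW.
- by rewrite in_itv/= leey lpdist_ge0.
Qed.

(** By monotone convergence the limit of the p-th powers is integrable, hence finite a.e.; its p-th
    root is the pointwise bound. *)
Lemma lpdist_bounded (s : nat -> T -> R) (c : R) :
  (forall n, measurable_fun setT (s n)) ->
  (forall n t, 0 <= s n t) -> (forall t, nondecreasing_seq (s ^~ t)) ->
  (forall n, lpdist (s n) <= c%:E)%E ->
  \forall t \ae mu, exists M, forall n, s n t <= M.
Proof.
move=> ms s0 nds sc.
pose f n t := (`|s n t| `^ p)%:E.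
have nd : forall x, setT x -> {homo f ^~ x : n m / (n <= m)%N >-> (n <= m)%E}.
  move=> t _ m n mn; rewrite lee_fin ge0_ler_powR ?nnegrE// ?(ltW p0)// !ger0_norm//.
  exact: nds.
have lcvg t : f n t @[n --> \oo] --> limn (f ^~ t).
  exact: (ereal_nondecreasing_is_cvgn (nd t I)).
have f0 n t : (0 <= f n t)%E by rewrite lee_fin powR_ge0.
have lim0 t : (0 <= limn (f ^~ t))%E.
  by apply: lime_ge; [exact: lcvg|exact: nearW].
have ifin : mu.-integrable setT (fun t => limn (f ^~ t)).
  apply/integrableP; split.
    apply: (emeasurable_fun_cvg f).
    - by move=> n; exact: measurable_pow.
    - by move=> t _; exact: lcvg.
  under eq_integral do rewrite gee0_abs//.
  rewrite monotone_convergence//; last by move=> n; exact: measurable_pow.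
  apply: (@le_lt_trans _ _ (c%:E `^ (expo / p)^-1%R)%E).
    apply: lime_le.
      apply: ereal_nondecreasing_is_cvgn => m n mn.
      apply: ge0_le_integral => //; try exact: measurable_pow.
      by move=> t _; exact: nd.
    apply: nearW => n; rewrite -lpdist_leE//.
    exact: le_trans (lpdist_ge0 _) (sc 0).
  by rewrite poweR_lty// ltry.
have := integrable_ae measurableT ifin.
apply: filterS => t /(_ I) lfin; exists (fine (limn (f ^~ t)) `^ p^-1) => n.
have : (f n t <= limn (f ^~ t))%E.
  by apply: lime_ge; [exact: lcvg|exists n => // m; exact: nd].
rewrite -(fineK lfin) lee_fin ger0_norm// => h.
have : (s n t `^ p) `^ p^-1 <= fine (limn (f ^~ t)) `^ p^-1.
  by apply: ge0_ler_powR; rewrite ?invr_ge0 ?nnegrE ?powR_ge0 ?(ltW p0) ?fine_ge0.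
by rewrite -powRrM mulfV ?gt_eqF// powRr1.
Qed.

End lpdist.

(** * Elementary inequalities and a convergence criterion *)

Lemma normc_ge0 (R : rcfType) (z : R[i]) : 0 <= Normc.normc z.
Proof. by case: z => a b; exact: sqrtr_ge0. Qed.

(** The hypothesis says 1 + c <= (1 + a) (1 + b). It covers both c <= a + b and c = a b, hence sums
    and products of functions alike. *)
Lemma ln1D_le (R : realType) (a b c : R) : 0 <= a -> 0 <= b -> 0 <= c ->
  c <= a + b + a * b -> ln (1 + c) <= ln (1 + a) + ln (1 + b).
Proof.
move=> a0 b0 c0 cab.
have pos (x : R) : 0 <= x -> 0 < 1 + x by move=> x0; rewrite ltr_wpDr.
rewrite -lnM ?posrE ?pos// ler_ln ?posrE ?mulr_gt0 ?pos//.
by rewrite mulrDl mul1r mulrDr mulr1; lra.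
Qed.

Lemma bernoulli_ineq (R : realDomainType) (x : R) (k : nat) : 0 <= x ->
  1 + k%:R * x <= (1 + x) ^+ k.
Proof.
move=> x0; elim: k => [|k ih]; first by rewrite mul0r addr0 expr0.
rewrite exprS.
have h : (1 + x) * (1 + k%:R * x) <= (1 + x) * (1 + x) ^+ k.
  by rewrite ler_wpM2l// addr_ge0.
apply: le_trans h; rewrite -natr1 mulrDl mul1r mulrDl mul1r mulrDr mulr1.
have : 0 <= x * (k%:R * x) by rewrite !mulr_ge0.
lra.
Qed.

(** Logarithm of Bernoulli's inequality. *)
Lemma ln1DM_le (R : realType) (x : R) (k : nat) : 0 <= x ->
  ln (1 + k%:R * x) <= k%:R * ln (1 + x).
Proof.
move=> x0; have x1 : 0 < 1 + x by rewrite ltr_wpDr.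
rewrite [leRHS]mulr_natl -lnXn// ler_ln ?posrE ?exprn_gt0//; last first.
  by rewrite ltr_wpDr// mulr_ge0.
exact: bernoulli_ineq.
Qed.

(* [1 - expR (- a) <= a], multiplied by [expR a]. *)
Lemma expR_sub1_le (R : realType) (a : R) : expR a - 1 <= a * expR a.
Proof.
have := expR_ge1Dx (- a); rewrite expRN => h.
have : (1 - a) * expR a <= (expR a)^-1 * expR a.
  by rewrite ler_wpM2r// expR_ge0.
rewrite mulVf ?gt_eqF ?expR_gt0//; lra.
Qed.

(** The sequence is, up to its first term, the series of its increments, which converges
    absolutely. *)
Lemma cvg_bounded_variation (R : realType) (x : nat -> R) (C : R) :
  (forall n, \sum_(k < n) `|x k.+1 - x k| <= C) -> cvgn x.
Proof.
move=> xC.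
have ncv : cvgn [normed series (telescope x)].
  apply: nondecreasing_is_cvgn.
    by apply: nondecreasing_series => n _ _; exact: normr_ge0.
  exists C => _ [n _ <-]; rewrite /= seriesEord.
  exact: xC.
have := normed_cvg ncv; rewrite telescopeK => h.
rewrite (_ : x = (fun n => (x n - x 0%N) + x 0%N)); last first.
  by apply/funext => n; rewrite subrK.
by apply: is_cvgD => //; exact: is_cvg_cst.
Qed.

(** * Pointwise bounds for log (1 + |f|) *)

Section logmod1.
Context d (T : measurableType d) (R : realType) (P : probability T R).
Implicit Types f g h : L0 P.

Local Notation one := (fun=> 1 : R).

Lemma normc_logmod1 f t : 1 + Normc.normc (f t) = expR (logmod one f t).
Proof. by rewrite /logmod mulr1 lnK// posrE ltr_wpDr// normc_ge0. Qed.

Lemma logmod1_cst (c : R[i]) : logmod one (c%:A : L0 P) =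
  (fun=> ln (1 + Normc.normc c)) %[ae P].
Proof.
apply: filterS2 (L0_scaleE c 1) (@L0_oneE _ T R P) => t e1 e2 _.
by rewrite /logmod e1// e2// !mulr1.
Qed.

Lemma logmod1N f : logmod one (- f) = logmod one f %[ae P].
Proof.
by apply: filterS (L0_oppE f) => t e _; rewrite /logmod e// normcN.
Qed.

Lemma logmod1D f g :
  \forall t \ae P, logmod one (f + g) t <= logmod one f t + logmod one g t.
Proof.
apply: filterS (L0_addE f g) => t e; rewrite /logmod !mulr1 e//.
apply: ln1D_le; rewrite ?normc_ge0//.
apply: le_trans (le_normcD _ _) _; rewrite lerDl.
by rewrite mulr_ge0 ?normc_ge0.
Qed.

Lemma logmod1M f g :
  \forall t \ae P, logmod one (f * g) t <= logmod one f t + logmod one g t.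
Proof.
apply: filterS (L0_mulE f g) => t e; rewrite /logmod !mulr1 e//.
apply: ln1D_le; rewrite ?normc_ge0// Normc.normcM lerDr.
by rewrite addr_ge0 ?normc_ge0.
Qed.

(** Where log (1 + |f|) <= n, one has |f| <= e^n <= k and [ln1DM_le] applies. Elsewhere the
    subadditive bound is used, and k >= 1 leaves room for the factor [k]. *)
Lemma logmod1M_tail f g (n k : nat) : (0 < k)%N -> expR n%:R <= k%:R :> R ->
  \forall t \ae P, logmod one (f * g) t <=
    (if `|logmod one f t| <= n%:R then 0 else logmod one f t) +
    k%:R * logmod one g t.
Proof.
move=> k0 nk; apply: filterS2 (L0_mulE f g) (logmod1M f g) => t e h.
case: ifPn => [|_].
  rewrite ger0_norm ?logmod1_ge0// add0r => fn.
  have fk : Normc.normc (f t) <= k%:R.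
    apply: le_trans nk; rewrite (@le_trans _ _ (1 + Normc.normc (f t)))//.
      by rewrite lerDr.
    by rewrite normc_logmod1 ler_expR.
  rewrite /logmod e// !mulr1 Normc.normcM; apply: le_trans (ln1DM_le _ _).
    rewrite ler_ln ?posrE ?ltr_wpDr ?mulr_ge0 ?normc_ge0// lerD2l.
    by rewrite ler_wpM2r ?normc_ge0.
  exact: normc_ge0.
apply: (le_trans h); rewrite lerD2l ler_peMl ?logmod1_ge0//.
by rewrite ler1n.
Qed.

End logmod1.

(** * The distance to 0 in L_p and its continuity properties *)

Section logL_norm.
Context d (T : measurableType d) (R : realType) (P : probability T R).
Variables (p : R) (p0 : 0 < p).

Local Notation one := (fun=> 1 : R).
Local Notation logd h := (lpdist P p (logmod one h)).

Lemma measurable_logmod1 (f : L0 P) : measurable_fun setT (logmod one f).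
Proof. exact: measurable_logmod. Qed.

Local Hint Resolve measurable_logmod1 : core.

Lemma lpdist_logmod_lty (w : T -> R) (f : L0 P) :
  (lpdist P p (logmod w f) < +oo)%E <-> logLw p w f.
Proof.
split; first by apply: lty_poweRy; rewrite gt_eqF// lt_min p0 ltr01.
exact: poweR_lty.
Qed.

Lemma lpdist_logL (f : logL P p0) :
  (fine (lpdist P p (logmod one f)))%:E = lpdist P p (logmod one f).
Proof.
rewrite fineK// ge0_fin_numE ?lpdist_ge0//; apply/lpdist_logmod_lty.
exact: (set_mem (logL_valP f)).
Qed.

Lemma eq_lpdist (u v : T -> R) : measurable_fun setT u ->
  measurable_fun setT v -> u = v %[ae P] -> lpdist P p u = lpdist P p v.
Proof.
move=> mu mv uv; apply/eqP; rewrite eq_le !le_lpdist//.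
- by apply: filterS uv => t ->.
- by apply: filterS uv => t ->.
Qed.

Lemma lpdist_cst (c : R) :
  lpdist P p (fun=> c) = (`|c| `^ Num.min p 1)%:E.
Proof.
rewrite /lpdist unlock /= integral_cst//=.
rewrite [X in (_ * X)%E](@probability_setT _ _ _ P) mule1.
by rewrite poweR_EFin -powRrM mulfV ?gt_eqF// powRr1.
Qed.

(** The triangle inequality for [k] equal summands, which treats p < 1 and p >= 1 at once. *)
Lemma lpdistMn (u : T -> R) (k : nat) : measurable_fun setT u ->
  (lpdist P p (fun t => k%:R * u t)%R <= k%:R%:E * lpdist P p u)%E.
Proof.
move=> mu; have := lpdist_sum P p0 k (fun=> mu).
rewrite (_ : (fun t => \sum_(i < k) u t) = fun t => k%:R * u t); last first.
  by apply/funext => t; rewrite sumr_const card_ord mulr_natl.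
move=> /le_trans; apply.
by rewrite sumr_const card_ord mule_natl.
Qed.

Definition logL_norm (f : logL P p0) : R := fine (logd f).

Lemma logL_normE f : (logL_norm f)%:E = logd f.
Proof. exact: lpdist_logL. Qed.

(** Stated for any [h] with the pointwise bound, so that it serves both [f + g] and [f * g]. *)
Lemma logL_normD_le (f g h : logL P p0) :
  (\forall t \ae P, logmod one h t <= logmod one f t + logmod one g t) ->
  logL_norm h <= logL_norm f + logL_norm g.
Proof.
move=> hfg; rewrite -lee_fin EFinD !logL_normE.
apply: le_trans (lpdistD _ _ _ _) => //; apply: le_lpdist => //.
  exact: measurable_funD.
by apply: filterS hfg => t; rewrite !ger0_norm ?addr_ge0 ?logmod1_ge0.
Qed.

Lemma logL_normN f : logL_norm (- f) = logL_norm f.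
Proof. by congr fine; apply: eq_lpdist => //; exact: logmod1N. Qed.

Lemma logL_norm_eq0 f : logL_norm f = 0 -> f = 0.
Proof.
move=> f0; have := logL_normE f; rewrite f0 => /esym/lpdist_eq0 => /(_ p0).
move=> /(_ (measurable_logmod1 _)) lf0; apply: val_inj; apply/L0P.
apply: filterS2 lf0 (@L0_zeroE _ T R P) => t /(_ I) e /(_ I) z _.
rewrite z; apply: Normc.eq0_normc; apply: (addrI 1).
by rewrite normc_logmod1 e expR0 addr0.
Qed.

Lemma logL_norm_alg (e : R) : 0 < e -> exists2 r : R[i], 0 < r &
  forall c : R[i], `|c| < r -> logL_norm c%:A < e.
Proof.
(* The norm of a constant is log (1 + |c|)^min(p,1), and log (1 + |c|) <= |c|; the radius inverts
   the exponent. *)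
move=> e0; exists ((e `^ (Num.min p 1)^-1)%:C)%C; first by rewrite ltcR powR_gt0.
have m0 : 0 < Num.min p 1 by rewrite lt_min p0 ltr01.
move=> c; have -> : `|c| = (Normc.normc c)%:C%C by case: c.
rewrite ltcR => ce.
rewrite -lte_fin logL_normE (eq_lpdist (v := fun=> ln (1 + Normc.normc c)))//; last first.
  exact: logmod1_cst.
rewrite lpdist_cst lte_fin.
have n0 := normc_ge0 c.
rewrite ger0_norm ?ln_ge0 ?lerDl//.
have : ln (1 + Normc.normc c) < e `^ (Num.min p 1)^-1.
  by apply: le_lt_trans ce; apply: le_ln1Dx; apply: lt_le_trans n0; rewrite ltrN10.
move=> /(gt0_ltr_powR m0) /=; rewrite -powRrM mulVf ?gt_eqF// powRr1 ?ltW//.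
by apply; rewrite nnegrE ?powR_ge0// ln_ge0// lerDl.
Qed.

(** The level [n] makes the tail of log (1 + |a|) smaller than e / 2. Below that level
    multiplication by [a] costs at most a factor [k], which the radius e / (2 k) compensates. *)
Lemma logL_normMl (a : logL P p0) (e : R) : 0 < e -> exists2 r, 0 < r &
  forall h, logL_norm h < r -> logL_norm (a * h) < e.
Proof.
move=> e0; have e2 : 0 < e / 2 by rewrite divr_gt0.
have afin : (logd a < +oo)%E by rewrite -logL_normE ltry.
have [n an] := lpdist_tail p0 (measurable_logmod1 a) afin e2.
pose k := Num.Def.archi_bound (expR n%:R : R).
have nk : expR n%:R < k%:R :> R by rewrite archi_boundP// expR_ge0.
have k0 : 0 < k%:R :> R by exact: le_lt_trans (expR_ge0 _) nk.
exists (e / 2 / k%:R); first by rewrite divr_gt0.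
move=> h hk; rewrite -lte_fin logL_normE [e]splitr EFinD.
have mtail : measurable_fun setT
    (fun t => if `|logmod one a t| <= n%:R then 0 else logmod one a t).
  apply: measurable_fun_ifT => //; apply: measurable_fun_ler => //.
  exact: measurableT_comp.
have mk : measurable_fun setT (fun t => k%:R * logmod one h t).
  exact: measurable_funM.
apply: (@le_lt_trans _ _ (lpdist P p (fun t => if (`|logmod one a t| <= n%:R)%R
    then 0%R else logmod one a t) + lpdist P p (fun t => k%:R * logmod one h t)%R)%E).
  apply: le_trans (lpdistD _ _ _ _) => //.
  apply: le_lpdist => //; first exact: measurable_funD.
  have k0' : (0 < k)%N by rewrite -(ltr0n R).
  apply: filterS (logmod1M_tail a h k0' (ltW nk)) => t aht.
  by apply: le_trans (ler_norm _); rewrite ger0_norm// logmod1_ge0.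
apply: lteD => //; apply: le_lt_trans (lpdistMn _ _) _ => //.
by rewrite -logL_normE -EFinM lte_fin mulrC -ltr_pdivlMr.
Qed.

End logL_norm.

(** * Completeness of L_p *)

Lemma sum_geometric_half_le (R : realFieldType) (n : nat) :
  \sum_(k < n) 2^-1 ^+ k <= 2 :> R.
Proof.
suff -> : \sum_(k < n) 2^-1 ^+ k = 2 - 2 * 2^-1 ^+ n :> R.
  by rewrite gerBl mulr_ge0// exprn_ge0// invr_ge0.
elim: n => [|n ih]; first by rewrite big_ord0 expr0 mulr1 subrr.
by rewrite big_ord_recr/= ih exprS; field.
Qed.

Lemma logmod1_cvg d (T : measurableType d) (R : realType) (P : probability T R)
    (f_ : nat -> L0 P) (f : L0 P) (t : T) :
  complex.Re (f_ n t) @[n --> \oo] --> complex.Re (f t) ->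
  complex.Im (f_ n t) @[n --> \oo] --> complex.Im (f t) ->
  logmod (fun=> 1) (f_ n) t @[n --> \oo] --> logmod (fun=> 1) f t.
Proof.
have E (h : L0 P) : logmod (fun=> 1) h t =
    ln (1 + Num.sqrt (complex.Re (h t) ^+ 2 + complex.Im (h t) ^+ 2)).
  by rewrite /logmod mulr1; case: (h t).
move=> fRe fIm; rewrite E.
rewrite (_ : (fun n => _) = fun n =>
    ln (1 + Num.sqrt (complex.Re (f_ n t) ^+ 2 + complex.Im (f_ n t) ^+ 2))); last first.
  by apply/funext => n; exact: E.
apply: continuous_cvg.
  by apply: continuous_ln; rewrite ltr_wpDr// sqrtr_ge0.
apply: cvgD; first exact: cvg_cst.
apply: continuous_cvg; first exact: sqrt_continuous.
by apply: cvgD; rewrite ?expr2; under eq_fun do rewrite expr2; apply: cvgM.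
Qed.

Section limit.
Context d (T : measurableType d) (R : realType).

Lemma measurable_limit (x : nat -> T -> R) :
  (forall n, measurable_fun setT (x n)) ->
  exists2 y : T -> R, measurable_fun setT y &
    forall t, cvgn (x ^~ t) -> x n t @[n --> \oo] --> y t.
Proof.
move=> mx; exists (fun t => fine (limn_esup (fun n => (x n t)%:E))).
  apply: (measurableT_comp (f := fine)) => //.
  apply: measurable_fun_limn_esup => n; exact/measurable_EFinP.
move=> t xt.
have /cvg_limn_einf_sup[_ ->] // : (x n t)%:E @[n --> \oo] --> (limn (x ^~ t))%:E.
by apply: cvg_EFin; [exact: nearW|exact: xt].
Qed.

End limit.

Section complete.
Context d (T : measurableType d) (R : realType) (P : probability T R).
Variables (p : R) (p0 : 0 < p).
Local Notation one := (fun=> 1 : R).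
Local Notation logd h := (lpdist P p (logmod one h%R)).

Lemma ae_logmod1B (f g : L0 P) : \forall t \ae P,
  1 + Normc.normc (f t - g t) = expR (logmod one (f - g) t).
Proof.
apply: filterS2 (L0_addE f (- g)) (L0_oppE g) => t e1 e2.
by rewrite -normc_logmod1 e1// e2.
Qed.

(** The logarithms a_k = log (1 + |v_{k+1} - v_k|) have a.e. bounded partial sums, since the
    distances add up to at most 2. Summability of the a_k then gives that of the increments
    themselves, so real and imaginary parts have bounded variation. *)
Lemma ae_cvg_summable (v : nat -> L0 P) :
  (forall k, (logd (v k.+1 - v k) <= (2^-1 ^+ k)%:E)%E) ->
  exists l : L0 P, \forall t \ae P,
    (complex.Re (v k t) @[k --> \oo] --> complex.Re (l t)) /\
    (complex.Im (v k t) @[k --> \oo] --> complex.Im (l t)).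
Proof.
move=> vd.
have mRe k : measurable_fun setT (fun t => complex.Re (v k t)).
  by have /measurable_complexP[] := measurable_L0 (v k).
have mIm k : measurable_fun setT (fun t => complex.Im (v k t)).
  by have /measurable_complexP[] := measurable_L0 (v k).
have [y1 my1 y1P] := measurable_limit mRe.
have [y2 my2 y2P] := measurable_limit mIm.
have my : measurable_fun setT (fun t => (y1 t +i* y2 t)%C).
  by apply/measurable_complexP; split.
exists (L0_class my).
pose a k t := logmod one (v k.+1 - v k) t.
have ma k : measurable_fun setT (a k) by exact: measurable_logmod.
have a0 k t : 0 <= a k t by exact: logmod1_ge0.
have bnd : \forall t \ae P, exists M, forall n, \sum_(k < n) a k t <= M.
  apply: (@lpdist_bounded _ _ _ _ _ p0 (fun n t => \sum_(k < n) a k t) 2).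
  - by move=> n; exact: measurable_sum.
  - by move=> n t; apply: sumr_ge0.
  - move=> t; apply/nondecreasing_seqP => n.
    by rewrite big_ord_recr/= lerDl.
  - move=> n; apply: (le_trans (lpdist_sum _ p0 n ma)).
    apply: (@le_trans _ _ (\sum_(k < n) (2^-1 ^+ k)%:E)%E).
      by apply: lee_sum => k _; exact: vd.
    by rewrite sumEFin lee_fin sum_geometric_half_le.
have diff : \forall t \ae P, forall k,
    1 + Normc.normc (v k.+1 t - v k t) = expR (a k t).
  by apply: ae_foralln => k; exact: ae_logmod1B.
apply: filterS3 bnd diff (L0_classE my) => t [M tM] tv /(_ I) ->/=.
(* Each increment equals e^{a_k} - 1 <= a_k e^{a_k} <= a_k e^M, because a single term a_k is at most
   the bound [M] of the partial sums. *)
have sumle n : \sum_(k < n) Normc.normc (v k.+1 t - v k t) <= M * expR M.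
  have M0 : 0 <= M by have := tM 0%N; rewrite big_ord0.
  apply: (@le_trans _ _ ((\sum_(k < n) a k t) * expR M)); last first.
    by rewrite ler_wpM2r ?expR_ge0.
  rewrite mulr_suml; apply: ler_sum => k _.
  have -> : Normc.normc (v k.+1 t - v k t) = expR (a k t) - 1.
    by rewrite -tv [RHS]addrAC subrr add0r.
  apply: (le_trans (expR_sub1_le _)).
  rewrite ler_wpM2l// ler_expR; apply: le_trans (tM k.+1).
  by rewrite big_ord_recr/= lerDr sumr_ge0.
(* The increments of the real and imaginary parts are at most the modulus of the complex
   increment. *)
split; [apply: y1P|apply: y2P]; apply: cvg_bounded_variation => n;
  apply: le_trans (sumle n); apply: ler_sum => k _.
- case: (v k.+1 t) (v k t) => [x1 x2] [z1 z2] /=.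
  by rewrite -sqrtr_sqr ler_sqrt ?addr_ge0 ?sqr_ge0// lerDl sqr_ge0.
- case: (v k.+1 t) (v k t) => [x1 x2] [z1 z2] /=.
  by rewrite -sqrtr_sqr ler_sqrt ?addr_ge0 ?sqr_ge0// lerDr sqr_ge0.
Qed.

(** Fatou's lemma, with [f] fixed, lets a distance bound pass to the a.e. limit of [v]. *)
Lemma lpdist_logmod1_le_lim (v : nat -> L0 P) (f l : L0 P) (c : \bar R) :
  (\forall t \ae P,
    (complex.Re (v k t) @[k --> \oo] --> complex.Re (l t)) /\
    (complex.Im (v k t) @[k --> \oo] --> complex.Im (l t))) ->
  (\forall k \near \oo, (logd (f - v k) <= c)%E) -> (logd (f - l) <= c)%E.
Proof.
move=> vl fc; apply: (lpdist_fatou p0 _ _ _ fc).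
- by move=> k; exact: measurable_logmod.
- exact: measurable_logmod.
have subE : \forall t \ae P, forall k, L0_fun (f - v k) t = f t - v k t.
  apply: ae_foralln => k.
  by apply: filterS2 (L0_addE f (- v k)) (L0_oppE (v k)) => t e1 e2; rewrite e1// e2.
have sublE : \forall t \ae P, L0_fun (f - l) t = f t - l t.
  by apply: filterS2 (L0_addE f (- l)) (L0_oppE l) => t e1 e2; rewrite e1// e2.
apply: filterS3 vl subE sublE => t [vRe vIm] e1 e2.
have ReB (x y : R[i]) : complex.Re (x - y) = complex.Re x - complex.Re y.
  by case: x y => [? ?] [? ?].
have ImB (x y : R[i]) : complex.Im (x - y) = complex.Im x - complex.Im y.
  by case: x y => [? ?] [? ?].
apply: logmod1_cvg; rewrite e2; under eq_fun do rewrite e1.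
- rewrite ReB; under eq_fun do rewrite ReB.
  by apply: cvgB => //; exact: cvg_cst.
- rewrite ImB; under eq_fun do rewrite ImB.
  by apply: cvgB => //; exact: cvg_cst.
Qed.

Lemma logL_complete (u : nat -> logL P p0) :
  (forall e, 0 < e -> exists n0, forall m n,
    (n0 <= m)%N -> (n0 <= n)%N -> logL_norm (u m - u n) < e) ->
  exists l, forall e, 0 < e -> exists n0, forall n,
    (n0 <= n)%N -> logL_norm (l - u n) < e.
Proof.
move=> uc.
have half0 k : 0 < 2^-1 ^+ k :> R by rewrite exprn_gt0// invr_gt0.
have /choice[nk nkP] : forall k, exists n0, forall m n,
    (n0 <= m)%N -> (n0 <= n)%N -> logL_norm (u m - u n) < 2^-1 ^+ k.
  by move=> k; exact: uc.
(* The sum puts [m k] beyond every [nk j] with j <= k, so both [m k] and [m k.+1] are beyond [nk k];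
   the summand [k] makes the indices tend to infinity. *)
pose m k := (k + \sum_(j < k.+1) nk j)%N.
have mnk j k : (j <= k)%N -> (nk j <= m k)%N.
  move=> jk; have jk1 : (j < k.+1)%N by [].
  by rewrite /m (bigD1 (Ordinal jk1))//= addnCA leq_addr.
have [l lP] : exists l : L0 P, \forall t \ae P,
    (complex.Re (L0_fun (u (m k)) t) @[k --> \oo] --> complex.Re (l t)) /\
    (complex.Im (L0_fun (u (m k)) t) @[k --> \oo] --> complex.Im (l t)).
  apply: (@ae_cvg_summable (fun k => u (m k) : L0 P)) => k.
  rewrite -(logL_normE (u (m k.+1) - u (m k))) lee_fin ltW//.
  by apply: nkP; apply: mnk.
(* With [n] fixed, the Cauchy bound on [u n - u (m k)] is carried to the limit in [k]. *)
have dist_le (e : R) : 0 < e -> exists n0, forall n, (n0 <= n)%N ->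
    (logd ((u n : L0 P) - l) <= e%:E)%E.
  move=> /uc[n0 n0P]; exists n0 => n n0n.
  apply: (lpdist_logmod1_le_lim lP); exists n0 => // k /= n0k.
  rewrite -(logL_normE (u n - u (m k))) lee_fin ltW//.
  by apply: n0P => //; apply: leq_trans n0k (leq_addr _ _).
have [n0 n0P] := dist_le 1 ltr01.
have ll : l \in logL_pred p0.
  (* So far [l] is only a measurable class; it is in L_p as the difference of [u n0] and an element
     of finite distance to 0. *)
  have -> : l = (u n0 : L0 P) - ((u n0 : L0 P) - l) by rewrite opprB addrCA subrr addr0.
  apply: rpredB; first exact: logL_valP.
  apply/mem_set/lpdist_logmod_lty => //.
  by apply: le_lt_trans (n0P n0 (leqnn _)) _; rewrite ltry.
exists (LogL ll) => e e0.
have e2 : 0 < e / 2 by rewrite divr_gt0.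
have [n1 n1P] := dist_le _ e2; exists n1 => n /n1P.
rewrite -(logL_normE (u n - LogL ll)) lee_fin => nl.
rewrite -(opprB (u n) (LogL ll)) logL_normN; apply: le_lt_trans nl _.
by rewrite ltr_pdivrMr// ltr_pMr// ltr1n.
Qed.

Lemma logL_F_norm : F_norm (@logL_norm _ _ _ P p p0).
Proof.
split.
(* The zero element is the scalar 0, so [logL_norm_alg] puts its norm below every positive [e]. *)
- apply/le_anti/andP; split; last by rewrite fine_ge0 ?lpdist_ge0.
  apply/ler_addgt0Pl => e /(logL_norm_alg P p0)[r r0 /(_ 0)].
  by rewrite normr0 scale0r addr0 => /(_ r0)/ltW.
- exact: logL_norm_eq0.
- exact: logL_normN.
- by move=> f g; apply: logL_normD_le; exact: logmod1D.
- move=> e e0; exists (e / 2); first by rewrite divr_gt0.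
  move=> f g fe ge; rewrite [e]splitr.
  apply: le_lt_trans (ltrD fe ge).
  by apply: logL_normD_le; exact: logmod1M.
- exact: logL_normMl.
- move=> a e /(logL_normMl a)[r r0 rP]; exists r => // f /rP.
  by rewrite mulrC.
- exact: logL_norm_alg.
- exact: logL_complete.
Qed.

End complete.

(** * Reduction of the weighted metric to the weight 1 *)

Section weighted.
Context d (T : measurableType d) (R : realType) (P : probability T R).
Variables (p : R) (p0 : 0 < p).

(** From 1 + e^u <= 2 e^|u| one gets log (1 + e^u) <= log 2 + |u|, and both terms have finite
    distance to 0. The use is with u = log w and u = - log w. *)
Lemma logL_expR (u : T -> R) : measurable_fun setT u ->
  (lpdist P p u < +oo)%E ->
  exists f : logL P p0, L0_fun f = (fun t => (expR (u t))%:C%C) %[ae P].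
Proof.
move=> mu ufin.
have me : measurable_fun setT (fun t => (expR (u t))%:C%C : R[i]).
  apply/measurable_complexP; split => //=.
  by apply: measurableT_comp => //; exact: measurable_expR.
suff fL : @L0_class _ _ _ P _ me \in logL_pred p0.
  by exists (LogL fL); exact: L0_classE.
apply/mem_set/lpdist_logmod_lty => //.
have mu1 : measurable_fun setT (fun t => `|u t|) by exact: measurableT_comp.
apply: (@le_lt_trans _ _ (lpdist P p (fun=> ln 2 : R) + lpdist P p (fun t => `|u t|%R))%E).
  apply: le_trans (lpdistD _ _ _ _) => //.
  apply: le_lpdist => //; first exact: measurable_logmod.
    exact: measurable_funD.
  apply: filterS (L0_classE me) => t /(_ I) e.
  have ln2 : 0 <= ln 2 :> R by rewrite ln_ge0// ler1n.
  rewrite ger0_norm ?logmod1_ge0// ger0_norm ?addr_ge0//.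
  rewrite -(expRK `|u t|) -lnM ?posrE ?expR_gt0//.
  rewrite /logmod e /= mulr1 expr0n /= addr0 sqrtr_sqr ger0_norm ?expR_ge0//.
  rewrite ler_ln ?posrE ?addr_gt0 ?mulr_gt0 ?expR_gt0//.
  rewrite mulr_natl mulr2n lerD//; first by rewrite -expR0 ler_expR.
  by rewrite ler_expR ler_norm.
apply: lte_add_pinfty; first by rewrite lpdist_cst//; first exact: ltry.
apply: le_lt_trans ufin; apply: le_lpdist => //.
by apply: nearW => t; rewrite normr_id.
Qed.

Lemma logrhoE (w : T -> R) (f g : L0 P) :
  logrho p w f g = fine (lpdist P p (logmod w (f - g)%R)).
Proof. by rewrite /logrho /lpdist fine_poweR. Qed.

Lemma logL_F_algebra (w : T -> R) : is_weight P w ->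
  finite_norm P p%:E (fun t => ln (w t)) ->
  is_F_algebra (fun f g : logL P p0 => logrho p w f g) /\
  same_topology
    (fun f g : logL P p0 => logrho p w f g)
    (fun f g : logL P p0 => logrho p (fun=> 1) f g).
Proof.
move=> [mw _ w_gt0] lnw.
have mln : measurable_fun setT (fun t => ln (w t)).
  exact: (measurableT_comp (@measurable_ln R)).
have mlnN : measurable_fun setT (fun t => - ln (w t)).
  exact: measurableT_comp.
have lfin : (lpdist P p (fun t => ln (w t)) < +oo)%E by exact: poweR_lty.
(* [W] represents exp (log w), which is [w] only where w > 0, hence a.e.; where w = 0 the default
   value of [ln] enters, on a null set. Using exponentials makes [W] and [V] exact inverses. *)
have [W WE] := logL_expR mln lfin.
have [V VE] : exists V : logL P p0,
    L0_fun V = (fun t => (expR (- ln (w t)))%:C%C) %[ae P].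
  apply: logL_expR => //; apply: le_lt_trans lfin; apply: le_lpdist => //.
  by apply: nearW => t; rewrite normrN.
have WV : W * V = 1.
  apply: val_inj; apply/L0P.
  apply: filterS3 (filterI WE VE) (L0_mulE W V) (@L0_oneE _ T R P).
  move=> t [+ +] + + _ => /(_ I) e1 /(_ I) e2 /(_ I) e3 /(_ I) e4.
  by rewrite e3 e1 e2 e4 -rmorphM -expRD subrr expR0.
(* Since |W| = w a.e., the weight can be moved inside the modulus as a factor [W]. *)
have rhow : (fun f g : logL P p0 => logrho p w f g) =
    (fun f g => logL_norm (W * (f - g))).
  apply/funext => f; apply/funext => g; rewrite logrhoE.
  congr fine; apply: eq_lpdist => //.
  - exact: measurable_logmod.
  - exact: measurable_logmod.
  apply: filterS3 w_gt0 WE (L0_mulE W (f - g : logL P p0)) => t wt e1 e2 _.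
  rewrite /logmod e2// e1// lnK ?posrE// Normc.normcM mulr1 mulrC.
  by rewrite /= expr0n /= addr0 sqrtr_sqr gtr0_norm.
have rho1 : (fun f g : logL P p0 => logrho p (fun=> 1) f g) =
    (fun f g => logL_norm (f - g)).
  by apply/funext => f; apply/funext => g; rewrite logrhoE.
have VW : V * W = 1 by rewrite mulrC.
have FN := logL_F_norm P p0.
have FW := F_norm_unit FN WV VW.
rewrite rhow rho1; split; first exact: F_norm_F_algebra FW.
have := F_norm_unit_topology FN WV VW; exact.
Qed.

End weighted.

Theorem theorem6p5 (R : realType) (p : R) (p0 : 0 < p) (w : circle R -> R) :
  is_weight (circle_measure R) w ->
  finite_norm (circle_measure R) p%:E (fun t => ln (w t)) ->
  is_F_algebra (fun f g : logL (circle_measure R) p0 => logrho p w f g) /\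
  same_topology
    (fun f g : logL (circle_measure R) p0 => logrho p w f g)
    (fun f g : logL (circle_measure R) p0 => logrho p (fun=> 1) f g).
Proof. exact: logL_F_algebra. Qed.
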